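(* Let $W_1(t),W_2(t)\in\mathbb{R}^{d\times d}$ be the weight matrices of the two-layer linear contrastive model, evolving under gradient flow of the InfoNCE loss, i.e. $$\dot W_1=-W_2^TG,\qquad \dot W_2=-GW_1^T,\qquad G=-W_2W_1X.$$ Let $W_1=U_1S_1V_1^T$ and $W_2=U_2S_2V_2^T$ be singular value decompositions, with $S_l=\mathrm{diag}(\sigma_l^1,\dots,\sigma_l^d)$ and with $\mathbf{v}_1^k$ the $k$-th column of $V_1$. If $W_2$ and $W_1$ are aligned, i.e. $V_2=U_1$, then for every $k$ the singular values evolve by $$\dot\sigma_1^k=\sigma_1^k(\sigma_2^k)^2\,\big({\mathbf{v}_1^k}^TX\mathbf{v}_1^k\big),\qquad \dot\sigma_2^k=\sigma_2^k(\sigma_1^k)^2\,\big({\mathbf{v}_1^k}^TX\mathbf{v}_1^k\big).$$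
   Context: Two-layer linear contrastive model: inputs $\mathbf{x}_1,\dots,\mathbf{x}_N\in\mathbb{R}^d$ with augmented versions $\mathbf{x}_1',\dots,\mathbf{x}_N'\in\mathbb{R}^d$; embeddings $\mathbf{z}_i=W_2W_1\mathbf{x}_i$, $\mathbf{z}_i'=W_2W_1\mathbf{x}_i'$. The InfoNCE loss is $$L=-\sum_{i=1}^N\log\frac{\exp(-|\mathbf{z}_i-\mathbf{z}_i'|^2/2)}{Z_i},\qquad Z_i=\sum_{j\ne i}\exp(-|\mathbf{z}_i-\mathbf{z}_j|^2/2)+\exp(-|\mathbf{z}_i-\mathbf{z}_i'|^2/2).$$ Softmax weights: $\alpha_{ij}=\exp(-|\mathbf{z}_i-\mathbf{z}_j|^2/2)/Z_i$ for $j\neq i$, $\alpha_{ii}=\exp(-|\mathbf{z}_i-\mathbf{z}_i'|^2/2)/Z_i$. The symmetric (in general time-dependent) matrix $X$ is $$X=\sum_i\Big(\sum_{j\neq i}\alpha_{ij}(\mathbf{x}_i'-\mathbf{x}_j)+\sum_{j\neq i}\alpha_{ji}(\mathbf{x}_i-\mathbf{x}_j)\Big)\mathbf{x}_i^T-\sum_i(1-\alpha_{ii})(\mathbf{x}_i'-\mathbf{x}_i)\mathbf{x}_i'^T .$$ The singular value decompositions ($U_l,V_l$ orthogonal, $S_l$ diagonal with nonnegative entries) are assumed to be differentiable functions of $t$. *)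

(* Defs.v *)
From HB Require Import structures.
From mathcomp Require Import all_boot all_order all_algebra.
From mathcomp Require Import all_classical all_reals all_analysis.

Set Implicit Arguments.
Unset Strict Implicit.
Unset Printing Implicit Defensive.

Import Order.TTheory GRing.Theory Num.Theory.
Import numFieldNormedType.Exports.

Local Open Scope classical_set_scope.
Local Open Scope ring_scope.

(* Derivative at t relative to a time domain J: one-sided at an endpoint of J,
   the usual derivative elsewhere (lemma [is_derive_inE]). *)
Definition is_derive_in (R : realType) (V : normedModType R) (J : set R)
    (f : R -> V) (t : R) (df : V) : Prop :=
  (fun s => (s - t)^-1 *: (f s - f t)) @ within J t^' --> df.

Definition derivable_in (R : realType) (V : normedModType R) (J : set R)
    (f : R -> V) : Prop :=
  forall t, J t -> exists df, is_derive_in J f t df.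

Lemma is_derive_inE (R : realType) (V : normedModType R) (J : set R)
    (f : R -> V) (t : R) (df : V) :
  J° t -> is_derive_in J f t df <-> is_derive t 1 f df.
Proof.
move=> Jt.
have eqF : within J t^' = [set P | (0 : R)^' [set h | P (h + t)]].
  apply/seteqP; split=> P.
    case/nbhs_ballP=> e /= e0 He; have := Jt; case/nbhs_ballP=> e' /= e'0 He'.
    apply/nbhs_ballP; exists (Num.min e e'); first by rewrite /= lt_min e0 e'0.
    move=> h; rewrite /ball /= sub0r normrN lt_min => /andP[he he'] h0.
    have dt : t - (h + t) = - h by rewrite opprD addrCA subrr addr0.
    apply: He; rewrite /ball /= ?dt ?normrN //.
      by apply: contra_neq h0 => /(congr1 (+%R^~ (- t))); rewrite addrK subrr.
    by apply: He'; rewrite /ball /= dt normrN.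
  case/nbhs_ballP=> e /= e0 He.
  apply/nbhs_ballP; exists e => // s; rewrite /ball /= => se st Js.
  rewrite -[s](subrK t); apply: He; last by rewrite subr_eq0.
  by rewrite /ball /= sub0r opprB.
have eqD : (fun s => (s - t)^-1 *: (f s - f t)) @ within J t^' =
   (fun h => h^-1 *: ((f \o shift t) (h *: (1 : R)) - f t)) @ (0 : R)^'.
  rewrite eqF; suff -> : (fun h => h^-1 *: ((f \o shift t) (h *: (1 : R)) - f t)) =
    (fun s => (s - t)^-1 *: (f s - f t)) \o (fun h => h + t) by [].
  by apply/funext => h /=; rewrite addrK /GRing.scale /= mulr1.
rewrite /is_derive_in eqD; split=> [fdf|[fd <-]]; last exact: fd.
have dfa : derivable f t 1 by apply/cvg_ex; exists df.
exact: DeriveDef dfa (cvg_lim (@norm_hausdorff _ V) fdf).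
Qed.

(* [`|v|] is the sup norm on matrices, hence an explicit Euclidean norm. *)
Definition sqnorm (R : realType) (d : nat) (v : 'cV[R]_d) : R :=
  \sum_(k < d) v k 0 ^+ 2.

Section Contrastive.
Context {R : realType} {d N : nat}.
Variables (x x' : 'I_N -> 'cV[R]_d) (W1 W2 : 'M[R]_d).

Definition embed (v : 'cV[R]_d) : 'cV[R]_d := W2 *m W1 *m v.

Definition similarity (u v : 'cV[R]_d) : R :=
  expR (- (sqnorm (embed u - embed v) / 2)).

Definition partition_fun (i : 'I_N) : R :=
  \sum_(j < N | j != i) similarity (x i) (x j) + similarity (x i) (x' i).

(* The diagonal weight compares x i with its augmentation x' i. *)
Definition alpha (i j : 'I_N) : R :=
  similarity (x i) (if j == i then x' i else x j) / partition_fun i.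

Definition contrastiveX : 'M[R]_d :=
  \sum_(i < N)
     (\sum_(j < N | j != i) alpha i j *: (x' i - x j)
      + \sum_(j < N | j != i) alpha j i *: (x i - x j)) *m (x i)^T
  - \sum_(i < N) ((1 - alpha i i) *: (x' i - x i)) *m (x' i)^T.

(* The matrix gradient, with respect to the product W2 W1, of the InfoNCE loss
   - \sum_i ln (similarity (x i) (x' i) / partition_fun i); the chain rule gives
   W2^T G and G W1^T as the gradients with respect to W1 and W2. *)
Definition gradG : 'M[R]_d := - (W2 *m W1 *m contrastiveX).

End Contrastive.

(* Singular values are not required to be ordered: ordering would conflict
   with differentiability in time when they cross. *)
Definition is_svd (R : realType) (d : nat) (W U : 'M[R]_d) (s : 'rV[R]_d)
    (V : 'M[R]_d) : Prop :=
  [/\ U^T *m U = 1%:M, V^T *m V = 1%:M, forall k, 0 <= s 0 k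
    & W = U *m diag_mx s *m V^T].

Definition quad_form (R : realType) (d : nat) (A : 'M[R]_d) (v : 'cV[R]_d) : R :=
  (v^T *m A *m v) 0 0.

(* Main.v *)
Require Import Defs.
From HB Require Import structures.
From mathcomp Require Import all_boot all_order all_algebra.
From mathcomp Require Import all_classical all_reals all_analysis.
From mathcomp Require Import ring.

(** Differentiating sigma_k = (U^T W V)_kk and using W = U S V^T, the terms
    with dU and dV are sigma_k times diagonal entries of U^T dU and V^T dV,
    which vanish because both matrices are antisymmetric.  Hence the derivative
    of sigma_k is (U^T dW V)_kk.  With V_2 = U_1 at time t, the gradient flow
    gives
      U_1^T dW_1 V_1 = S_2^2 S_1 (V_1^T X V_1),
      U_2^T dW_2 V_2 = S_2 S_1 (V_1^T X V_1) S_1. *)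

Set Implicit Arguments.
Unset Strict Implicit.
Unset Printing Implicit Defensive.

Import Order.TTheory GRing.Theory Num.Theory.
Import numFieldNormedType.Exports.

Local Open Scope classical_set_scope.
Local Open Scope ring_scope.

Section RelativeDerivative.
Context {R : realType} (J : set R) (t : R).

Let F := within J t^'.

Lemma is_derive_in_continuous (f : R -> R) (df : R) :
  is_derive_in J f t df -> f s @[s --> F] --> f t.
Proof.
move=> fdf.
(* The rewritten form holds at [s = t] too, where the factor [s - t] vanishes whatever the quotient
   is. Away from [t] it exhibits [f] as a null factor times a convergent quotient, plus [f t]. *)
have -> : f = (fun s => (s - t) * ((s - t)^-1 *: (f s - f t)) + f t).
  apply/funext => s; have [->|st] := eqVneq s t.
    by rewrite subrr mul0r add0r.
  by rewrite /GRing.scale /= mulVKf ?subr_eq0// subrK.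
rewrite subrr mul0r add0r -[X in _ --> X]add0r -[X in X + _](mul0r df).
apply: cvgD; last exact: cvg_cst.
apply: cvgM fdf; rewrite -[X in _ --> X](subrr t).
apply: cvgB; last exact: cvg_cst.
by apply: cvg_within_filter; apply: cvg_within.
Qed.

Lemma is_derive_inM (f g : R -> R) (df dg : R) :
  is_derive_in J f t df -> is_derive_in J g t dg ->
  is_derive_in J (fun s => f s * g s) t (df * g t + f t * dg).
Proof.
move=> fdf gdg; rewrite /is_derive_in.
(* The first summand keeps [g] at [s], so its limit needs the continuity of [g] at [t] along [F]. *)
have -> : (fun s => (s - t)^-1 *: (f s * g s - f t * g t)) =
    (fun s => ((s - t)^-1 *: (f s - f t)) * g s
              + f t * ((s - t)^-1 *: (g s - g t))).
  by apply/funext => s; rewrite /GRing.scale /=; ring.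
apply: cvgD; first exact: cvgM fdf (is_derive_in_continuous gdg).
by apply: cvgM gdg; exact: cvg_cst.
Qed.

Lemma is_derive_in_sum (I : Type) (r : seq I) (f : I -> R -> R) (df : I -> R) :
  (forall i, is_derive_in J (f i) t (df i)) ->
  is_derive_in J (fun s => \sum_(i <- r) f i s) t (\sum_(i <- r) df i).
Proof.
move=> fdf; rewrite /is_derive_in.
have -> : (fun s => (s - t)^-1 *: (\sum_(i <- r) f i s - \sum_(i <- r) f i t)) =
    (fun s => \sum_(i <- r) (s - t)^-1 *: (f i s - f i t)).
  by apply/funext => s; rewrite -sumrB scaler_sumr.
apply: cvg_big => [|i _]; last exact: fdf.
exact: add_continuous.
Qed.

Lemma is_derive_in_cst (V : normedModType R) (c : V) :
  is_derive_in J (fun=> c) t 0.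
Proof.
rewrite /is_derive_in; under eq_fun do rewrite subrr scaler0.
exact: cvg_cst.
Qed.

(** The decomposition and orthogonality identities hold only on [J]; this transfers derivatives
    along them. The filter sees only points of [J], and [J t] fixes the base value [f t]. *)
Lemma eq_is_derive_in (V : normedModType R) (f g : R -> V) (df : V) :
  J t -> {in J, f =1 g} -> is_derive_in J f t df -> is_derive_in J g t df.
Proof.
move=> Jt fg; apply: cvg_trans; apply: near_eq_cvg; rewrite /= !near_withinE.
by apply: nearW => s _ Js; rewrite !fg ?inE.
Qed.

(** Working by entries reduces the matrix product rule to sums and products of real functions. *)
Definition entrywise_derive m n (A : R -> 'M[R]_(m, n)) (dA : 'M[R]_(m, n)) :=
  forall i j, is_derive_in J (fun s => A s i j) t (dA i j).

(** Taking an entry is linear and continuous, so it commutes with difference quotients and with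
    their limit. *)
Lemma is_derive_in_entrywise m n (A : R -> 'M[R]_(m, n)) dA :
  is_derive_in J A t dA -> entrywise_derive A dA.
Proof.
move=> AdA i j; rewrite /is_derive_in.
have -> : (fun s => (s - t)^-1 *: (A s i j - A t i j)) =
    (fun M : 'M[R]_(m, n) => M i j) \o (fun s => (s - t)^-1 *: (A s - A t)).
  by apply/funext => s /=; rewrite !mxE.
apply: continuous_cvg AdA; exact: coord_continuous.
Qed.

Lemma entrywise_derive_trmx m n (A : R -> 'M[R]_(m, n)) dA :
  entrywise_derive A dA -> entrywise_derive (fun s => (A s)^T) dA^T.
Proof.
move=> AdA i j; rewrite mxE.
by under [X in is_derive_in _ X]eq_fun do rewrite mxE; exact: AdA.
Qed.

Lemma entrywise_deriveM m n p (A : R -> 'M[R]_(m, n)) (B : R -> 'M[R]_(n, p))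
    dA dB :
  entrywise_derive A dA -> entrywise_derive B dB ->
  entrywise_derive (fun s => A s *m B s) (dA *m B t + A t *m dB).
Proof.
move=> AdA BdB i j; under [X in is_derive_in _ X]eq_fun do rewrite mxE.
rewrite !mxE -big_split /=; apply: is_derive_in_sum => k.
exact: is_derive_inM.
Qed.

(* Where [t] is isolated in [J], the filter is improper and every value is a
   derivative. *)
Lemma is_derive_in_isolated (V : normedModType R) (f : R -> V) (df : V) :
  F set0 -> is_derive_in J f t df.
Proof. by move=> F0 A _; apply: filterS F0. Qed.

Lemma is_derive_in_unique (V : normedModType R) (f : R -> V) (df df' : V) :
  ~ F set0 -> is_derive_in J f t df -> is_derive_in J f t df' -> df = df'.
Proof.
move=> F0; have FF : ProperFilter F by exact: Build_ProperFilter.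
exact: cvg_unique.
Qed.

(** Differentiating the constant [U^T U] gives [dU^T U + U^T dU = 0]. Concluding that the derivative
    is 0 requires limits along [F] to be unique, hence [~ F set0]. *)
Lemma orthogonal_derive_diag n (U : R -> 'M[R]_n) dU (k : 'I_n) :
  J t -> ~ F set0 -> {in J, forall s, (U s)^T *m U s = 1%:M} ->
  entrywise_derive U dU -> ((U t)^T *m dU) k k = 0.
Proof.
move=> Jt F0 UU UdU.
have /(_ k k) dUU := entrywise_deriveM (entrywise_derive_trmx UdU) UdU.
have eq1 : {in J, (fun s => ((U s)^T *m U s) k k) =1 fun=> 1%:M k k}.
  by move=> s /UU ->.
have := is_derive_in_unique F0 (eq_is_derive_in Jt eq1 dUU)
  (is_derive_in_cst (1%:M k k : R)).
(* The two terms of the product rule are transposes of each other, so their diagonal entries agree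
   and twice the entry is 0. *)
have -> : dU^T *m U t = ((U t)^T *m dU)^T by rewrite trmx_mul trmxK.
rewrite mxE [X in X + _]mxE -mulr2n => /eqP.
by rewrite mulrn_eq0 => /eqP.
Qed.

Lemma singular_value_derive n (W U V : R -> 'M[R]_n) (sigma : R -> 'rV[R]_n)
    dW dU dV (k : 'I_n) :
  J t -> (forall s, J s -> is_svd (W s) (U s) (sigma s) (V s)) ->
  is_derive_in J W t dW -> is_derive_in J U t dU -> is_derive_in J V t dV ->
  is_derive_in J (fun s => sigma s 0 k) t (((U t)^T *m dW *m V t) k k).
Proof.
move=> Jt svd /is_derive_in_entrywise WdW /is_derive_in_entrywise UdU
  /is_derive_in_entrywise VdV.
(* An isolated [t], as when [J] is a single point, is settled apart: antisymmetry cannot be derived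
   there. *)
have [F0|F0] := pselect (F set0); first exact: is_derive_in_isolated.
have UU : {in J, forall s, (U s)^T *m U s = 1%:M}.
  by move=> s; rewrite inE => /svd[].
have VV : {in J, forall s, (V s)^T *m V s = 1%:M}.
  by move=> s; rewrite inE => /svd[].
have sigmaE : {in J, (fun s => ((U s)^T *m W s *m V s) k k) =1
                     (fun s => sigma s 0 k)}.
  move=> s; rewrite inE => /svd[UsU VsV _ ->].
  by rewrite !mulmxA UsU mul1mx -mulmxA VsV mulmx1 mxE eqxx.
have := entrywise_deriveM (entrywise_deriveM (entrywise_derive_trmx UdU) WdW)
  VdV.
move/(_ k k)/(eq_is_derive_in Jt sigmaE).
have [UtU VtV _ Wt] := svd t Jt.
have dU0 : (dU^T *m W t *m V t) k k = 0.
  rewrite Wt -!mulmxA VtV mulmx1 mulmxA mul_mx_diag mxE.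
  have -> : dU^T *m U t = ((U t)^T *m dU)^T by rewrite trmx_mul trmxK.
  by rewrite mxE (orthogonal_derive_diag k Jt F0 UU UdU) mul0r.
have dV0 : ((U t)^T *m W t *m dV) k k = 0.
  rewrite Wt !mulmxA UtU mul1mx -mulmxA mul_diag_mx mxE.
  by rewrite (orthogonal_derive_diag k Jt F0 VV VdV) mulr0.
by rewrite mulmxDl !mxE in dU0 dV0 *; rewrite dU0 dV0 add0r addr0.
Qed.

End RelativeDerivative.

Lemma quad_formE (R : realType) n (A V : 'M[R]_n) (k : 'I_n) :
  quad_form A (col k V) = (V^T *m A *m V) k k.
Proof.
rewrite /quad_form tr_col -row_mul [LHS]mxE [RHS]mxE.
by apply: eq_bigr => i _; rewrite !mxE.
Qed.

Theorem theorem3 (R : realType) (d N : nat) (x x' : 'I_N -> 'cV[R]_d)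
    (J : interval R) (W1 W2 : R -> 'M[R]_d)
    (U1 V1 U2 V2 : R -> 'M[R]_d) (sigma1 sigma2 : R -> 'rV[R]_d)
    (flow1 : forall t, [set` J] t ->
       is_derive_in [set` J] W1 t
         (- ((W2 t)^T *m gradG x x' (W1 t) (W2 t))))
    (flow2 : forall t, [set` J] t ->
       is_derive_in [set` J] W2 t
         (- (gradG x x' (W1 t) (W2 t) *m (W1 t)^T)))
    (svd1 : forall t, [set` J] t -> is_svd (W1 t) (U1 t) (sigma1 t) (V1 t))
    (svd2 : forall t, [set` J] t -> is_svd (W2 t) (U2 t) (sigma2 t) (V2 t))
    (dU1 : derivable_in [set` J] U1) (dsigma1 : derivable_in [set` J] sigma1)
    (dV1 : derivable_in [set` J] V1)
    (dU2 : derivable_in [set` J] U2) (dsigma2 : derivable_in [set` J] sigma2)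
    (dV2 : derivable_in [set` J] V2)
    (t : R) (tJ : [set` J] t) (aligned : V2 t = U1 t) (k : 'I_d) :
  let q := quad_form (contrastiveX x x' (W1 t) (W2 t)) (col k (V1 t)) in
  is_derive_in [set` J] (fun s => sigma1 s 0 k) t
    (sigma1 t 0 k * sigma2 t 0 k ^+ 2 * q) /\
  is_derive_in [set` J] (fun s => sigma2 s 0 k) t
    (sigma2 t 0 k * sigma1 t 0 k ^+ 2 * q).
Proof.
move=> q.
have [dU1t U1d] := dU1 t tJ; have [dV1t V1d] := dV1 t tJ.
have [dU2t U2d] := dU2 t tJ; have [dV2t V2d] := dV2 t tJ.
have [UU1 VV1 _ W1E] := svd1 t tJ; have [UU2 VV2 _ W2E] := svd2 t tJ.
set X := contrastiveX x x' (W1 t) (W2 t) in q *.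
(* Alignment turns the inner factor [V2^T U1] into the identity, so the two diagonal matrices
   meet. *)
have W2W1 : W2 t *m W1 t =
    U2 t *m diag_mx (sigma2 t) *m diag_mx (sigma1 t) *m (V1 t)^T.
  by rewrite W1E W2E aligned !mulmxA -(mulmxA _ (U1 t)^T) UU1 mulmx1.
split.
- have := singular_value_derive (k := k) tJ svd1 (flow1 t tJ) U1d V1d.
  rewrite /gradG -/X !(mulmxN, mulNmx) opprK.
  (* Here [W2^T = U1 S2 U2^T] supplies the second factor [S2]: [U1^T] cancels on its left and
     [U2^T U2] on its right. *)
  suff -> : (U1 t)^T *m ((W2 t)^T *m (W2 t *m W1 t *m X)) *m V1 t =
      diag_mx (sigma2 t) *m (diag_mx (sigma2 t) *m (diag_mx (sigma1 t) *m
        ((V1 t)^T *m X *m V1 t))).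
    (* Diagonal factors only rescale rows, so the [k]-th diagonal entry is a scalar multiple of that
       of [Y = V1^T X V1]. *)
    rewrite !mul_diag_mx /q quad_formE; move: (_ *m X *m _) => Y.
    by rewrite !mxE; congr (is_derive_in _ _ _ _); ring.
  rewrite W2W1 W2E aligned !trmx_mul trmxK tr_diag_mx !mulmxA UU1 mul1mx.
  by rewrite -(mulmxA _ (U2 t)^T) UU2 mulmx1.
- have := singular_value_derive (k := k) tJ svd2 (flow2 t tJ) U2d V2d.
  rewrite /gradG -/X !(mulmxN, mulNmx) opprK.
  (* Now [W1^T = V1 S1 U1^T] meets [V2 = U1], which leaves the second [S1] on the right, where it
     rescales columns. *)
  suff -> : (U2 t)^T *m (W2 t *m W1 t *m X *m (W1 t)^T) *m V2 t =
      diag_mx (sigma2 t) *m (diag_mx (sigma1 t) *m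
        ((V1 t)^T *m X *m V1 t)) *m diag_mx (sigma1 t).
    rewrite mul_mx_diag !mul_diag_mx /q quad_formE.
    move: (_ *m X *m _) => Y.
    by rewrite !mxE; congr (is_derive_in _ _ _ _); ring.
  rewrite W2W1 W1E aligned !trmx_mul trmxK tr_diag_mx !mulmxA UU2 mul1mx.
  by rewrite -(mulmxA _ (U1 t)^T) UU1 mulmx1.
Qed.
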